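(* Let $g:(1,+\infty)\to\mathbb{R}$ be a $C^2$ function which has at most countably many zeros on $(1,+\infty)$. Then for Lebesgue-almost every real number $\beta>1$, the sequence $\left(e^{2\pi i \beta^n g(\beta)}\right)_{n\in\mathbb{N}}$ is a Chowla sequence.
   Context: $\mathbb{N}=\{0,1,2,\dots\}$, $\mathbb{N}_{\ge 2}=\mathbb{N}\setminus\{0,1\}$, and $S^1$ is the unit circle in $\mathbb{C}$. For $m\in\mathbb{N}_{\ge2}$ let $U(m)=\{e^{2\pi i k/m}:0\le k\le m-1\}$, and $U(\infty)=S^1$. The index of a sequence $z=(z(n))_{n\in\mathbb{N}}\in(S^1\cup\{0\})^{\mathbb{N}}$ is the smallest $m\in\mathbb{N}_{\ge2}\cup\{\infty\}$ such that $\{n\in\mathbb{N}: z(n)\notin U(m)\cup\{0\}\}$ has density zero in $\mathbb{N}$, i.e. $\frac1N\#\{0\le n\le N-1: z(n)\notin U(m)\cup\{0\}\}\to0$. For $x\in S^1\cup\{0\}$ and $n\in\mathbb{Z}$, put $x^{(n)}=x^n$ if $x\in S^1$ and $x^{(n)}=0$ if $x=0$; write $z^{(i)}(n)=(z(n))^{(i)}$. Let $I(m)=\{0,1,\dots,m-1\}$ if $m\in\mathbb{N}_{\ge2}$, and $I(\infty)=\mathbb{Z}$. A sequence $z\in(S^1\cup\{0\})^{\mathbb{N}}$ of index $m$ has the Chowla property (is a Chowla sequence) if $$\lim_{N\to\infty}\frac1N\sum_{n=0}^{N-1} z^{(i_1)}(n+a_1)\,z^{(i_2)}(n+a_2)\cdots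 z^{(i_r)}(n+a_r)=0$$ for every $r\ge1$, all integers $0\le a_1<\dots<a_r$ and all $i_1,\dots,i_r\in I(m)$ not all equal to $0$. *)

(* Defs.v *)
From HB Require Import structures.
From mathcomp Require Export all_boot all_order all_algebra.
From mathcomp Require Export complex.
From mathcomp Require Export all_classical all_reals all_analysis.
Export Order.TTheory GRing.Theory Num.Theory.
Export numFieldNormedType.Exports.

Set Implicit Arguments.
Unset Strict Implicit.
Unset Printing Implicit Defensive.

Local Open Scope classical_set_scope.
Local Open Scope ring_scope.
Local Open Scope complex_scope.

Section ChowlaSequences.
Variable R : realType.

Definition cis2pi (t : R) : R[i] := cos (2 * pi * t) +i* sin (2 * pi * t).

Definition unit_circle : set R[i] := [set x | `|x| = 1].

(* The possible indices, N_{>=2} together with infinity, are encoded in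
   [option nat]: [Some m] with [1 < m] is the integer m, [None] is infinity. *)
Definition valid_index (m : option nat) : Prop :=
  if m is Some k then (1 < k)%N else True.

Definition index_le (m m' : option nat) : Prop :=
  match m, m' with
  | _, None => True
  | None, Some _ => False
  | Some k, Some k' => (k <= k')%N
  end.

Definition mu_group (m : option nat) : set R[i] :=
  if m is Some k then [set x | exists2 j, (j < k)%N & x = cis2pi (j%:R / k%:R)]
  else unit_circle.

Definition exponents (m : option nat) : set int :=
  if m is Some k then [set i | (0 <= i < k%:Z)%R] else setT.

Definition density_zero (A : set nat) : Prop :=
  (#|[pred n : 'I_N | (n : nat) \in A]|%:R / N%:R : R) @[N --> \oo] --> (0 : R).

Definition concentrated (z : nat -> R[i]) (m : option nat) : Prop :=
  density_zero [set n | ~ (mu_group m `|` [set 0]) (z n)].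

Definition is_index (z : nat -> R[i]) (m : option nat) : Prop :=
  [/\ valid_index m, concentrated z m &
      forall m', valid_index m' -> concentrated z m' -> index_le m m'].

(* [0] is sent to [0] for every exponent, including the exponent [0]. *)
Definition power (x : R[i]) (n : int) : R[i] := if x == 0 then 0 else x ^ n.

(* The regular algebra [R[i]^o] carries the topology of the modulus; [R[i]]
   itself has no declared topology. *)
Definition Chowla (z : nat -> R[i]) : Prop :=
  (forall n, (unit_circle `|` [set 0]) (z n)) /\
  exists2 m, is_index z m &
    forall (r : nat) (a : 'I_r -> nat) (i : 'I_r -> int),
      (1 <= r)%N ->
      (forall j k : 'I_r, (j < k)%N -> (a j < a k)%N) ->
      (forall j, exponents m (i j)) ->
      (exists j, i j != 0) ->
      ((\sum_(n < N) \prod_(j < r) power (z (n + a j)%N) (i j)) / N%:R : R[i]^o)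
        @[N --> \oo] --> (0 : R[i]^o).

(* For open [D] this depends only on the restriction of [f] to [D]. *)
Definition C2_on (D : set R) (f : R -> R) : Prop :=
  forall x, D x ->
    [/\ derivable f x 1, derivable (derive1 f) x 1 & {for x, continuous (derive1n 2 f)}].

End ChowlaSequences.

(* Main.v *)
Require Import Defs.
From mathcomp Require Import measurable_realfun ring lra.

Set Implicit Arguments.
Unset Strict Implicit.
Unset Printing Implicit Defensive.

Local Open Scope classical_set_scope.
Local Open Scope ring_scope.

(** For fixed exponents and shifts, the correlation average of the sequence is
    the average of [e^{i beta^n u(beta)}] where [u = 2 pi p g] and [p] is a
    nonzero integer polynomial.  Off the countable zero set of [u], a point has
    a compact neighbourhood on which [u] is bounded away from 0.  There
    [F = x^n u - x^m u] ([m < n]) satisfies [|F'| >= d n x^n] for large [n] and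
    [|F''| <= E F'^2 / n], so integration by parts makes [int cos F] of size
    [O(1 / n)] and the mean square of the [N]-th exponential sum [O(N)].  Hence
    the averages along [N = k^2] are square summable in L^2 and tend to 0 almost
    everywhere, and consecutive squares are close enough to interpolate.  There
    are only countably many polynomials [p].  The index is infinite, because
    [z^k] has mean 0 for every [k > 0]. *)

(** * Integral bounds obtained from explicit primitives *)

Section PrimitiveDominated.
Variable R : realType.
Variables a b : R.

(* Yields [\int_a^b phi <= 2 C] when [phi] is nonnegative, yet is additive in
   [(phi, C)] without any integrability side condition. *)
Definition primitive_dominated (phi : R -> R) (C : R) : Prop :=
  exists Th th : R -> R, forall x, x \in `[a, b] ->
    [/\ is_derive x 1 Th (th x), {for x, continuous th}, `|Th x| <= C
      & phi x <= th x].

Lemma primitive_dominatedW (phi psi : R -> R) (C D : R) :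
  (forall x, x \in `[a, b] -> psi x <= phi x) -> C <= D ->
  primitive_dominated phi C -> primitive_dominated psi D.
Proof.
move=> le_psi leCD [Th [th H]]; exists Th, th => x xab.
have [dTh cth bTh phith] := H x xab; split=> //.
  exact: le_trans bTh leCD.
exact: le_trans (le_psi x xab) phith.
Qed.

Lemma primitive_dominatedD (phi psi : R -> R) (C D : R) :
  primitive_dominated phi C -> primitive_dominated psi D ->
  primitive_dominated (fun x => phi x + psi x) (C + D).
Proof.
move=> [Th [th H]] [Ps [ps H']]; exists (Th + Ps), (th + ps) => x xab.
have [dTh cth bTh phith] := H x xab.
have [dPs cps bPs psips] := H' x xab; split.
- exact: is_deriveD.
- exact: continuousD.
- by rewrite (le_trans (ler_normD _ _))// lerD.
- exact: lerD.
Qed.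

Lemma primitive_dominated_cst (k : R) : 0 <= a -> 0 <= k ->
  primitive_dominated (fun=> k) (k * b).
Proof.
move=> a0 k0; exists (k \*: id), (cst k) => x /[!in_itv]/= /andP[ax xb].
have x0 := le_trans a0 ax.
split => //; last 1 first.
- by rewrite /= normrM !ger0_norm// ler_wpM2l.
- by apply: is_derive_eq; rewrite [LHS]mulr1.
- exact: cvg_cst.
Qed.

Lemma primitive_dominated_sum (n : nat) (phi : nat -> R -> R) (C : R) :
  0 <= a -> (forall m, (m < n)%N -> primitive_dominated (phi m) C) ->
  primitive_dominated (fun x => \sum_(m < n) phi m x) (n%:R * C).
Proof.
move=> a0; elim: n => [|n IHn] H.
  have := @primitive_dominated_cst 0 a0 (lexx _); apply: primitive_dominatedW.
    by move=> x _; rewrite big_ord0.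
  by rewrite !mul0r.
have := primitive_dominatedD (IHn (fun m mn => H m (ltnW mn))) (H n (ltnSn n)).
apply: primitive_dominatedW; last by rewrite -natr1 mulrDl mul1r.
by move=> x _; rewrite big_ord_recr.
Qed.

(* Integration by parts: [sin F / F'] has derivative
   [cos F - sin F * F'' / F' ^ 2]. *)
Lemma primitive_dominated_cos (F F1 F2 : R -> R) (L E : R) :
  0 <= a -> 0 < L -> 0 <= E ->
  (forall x, x \in `[a, b] ->
     [/\ is_derive x 1 F (F1 x), is_derive x 1 F1 (F2 x),
         {for x, continuous F2}, L <= `|F1 x| & `|F2 x| <= E * F1 x ^+ 2]) ->
  primitive_dominated (fun x => cos (F x)) (L^-1 + E * b).
Proof.
move=> a0 L0 E0 H.
(* The linear term adds [E] to the derivative, which absorbs the error [sin F * F2 / F1 ^ 2] because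
   [|F2| <= E * F1 ^ 2]. It costs at most [E * b] in the size of the primitive, while [sin F / F1]
   costs [L^-1]. *)
pose G := ((fun x => sin (F x)) * (fun x => (F1 x)^-1)) + (E \*: id) : R -> R.
pose G1 := fun x : R => cos (F x) - sin (F x) * F2 x * (F1 x ^- 2) + E.
exists G, G1 => x xab.
have [dF dF1 cF2 LF1 F2E] := H x xab.
have F10 : F1 x != 0 by rewrite -normr_gt0 (lt_le_trans L0).
have cF : {for x, continuous F}.
  by apply/differentiable_continuous/derivable1_diffP; case: dF.
have cF1 : {for x, continuous F1}.
  by apply/differentiable_continuous/derivable1_diffP; case: dF1.
split.
- have dV := is_deriveV F10 dF1.
  have dS : is_derive x 1 (fun x => sin (F x)) (cos (F x) * F1 x).
    exact: is_derive1_comp.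
  apply: is_derive_eq.
  rewrite /G1 /= /GRing.scale /= mulr1.
  by field.
- apply: cvgD; last exact: cvg_cst.
  apply: cvgB.
    by apply: continuous_comp => //; exact: continuous_cos.
  apply: cvgM; first apply: cvgM => //.
    by apply: continuous_comp => //; exact: continuous_sin.
  apply: cvgV; first by rewrite expf_neq0.
  exact: cvgM.
- rewrite /G (le_trans (ler_normD _ _))// lerD//=.
    rewrite [X in `|X|](_ : _ = sin (F x) * (F1 x)^-1)// normrM normfV.
    rewrite -[leRHS]mul1r ler_pM ?invr_ge0//.
      by rewrite ler_norml sin_geN1 sin_le1.
    by rewrite lef_pV2// ?posrE ?normr_gt0.
  have /andP[ax xb] : a <= x <= b by rewrite in_itv in xab.
  rewrite normrM !ger0_norm// ?ler_wpM2l//.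
  exact: le_trans ax.
- rewrite /G1 -addrA lerDl addrC subr_ge0.
  rewrite (le_trans (ler_norm _))// -mulrA normrM -[leRHS]mul1r ler_pM//.
    by rewrite ler_norml sin_geN1 sin_le1.
  rewrite normrM normfV normrX real_normK ?num_real//.
  by rewrite ler_pdivrMr// exprn_even_gt0.
Qed.

(** The continuous majorant [th] integrates to [Th b - Th a] by the fundamental theorem of calculus,
    and each endpoint value costs [C]. *)
Lemma primitive_dominated_integral (phi : R -> R) (C : R) : a < b ->
  (forall x, 0 <= phi x) -> measurable_fun `[a, b] phi ->
  primitive_dominated phi C ->
  (\int[@lebesgue_measure R]_(x in `[a, b]) (phi x)%:E <= (C *+ 2)%:E)%E.
Proof.
move=> ab phi0 mphi [Th [th H]].
have inab x : x \in `]a, b[ -> x \in `[a, b] by exact: subset_itv_oo_cc.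
have cTh x : x \in `[a, b] -> {for x, continuous Th}.
  move=> xab; apply/differentiable_continuous/derivable1_diffP.
  by have [[]] := H x xab.
have aab : a \in `[a, b] by rewrite in_itv/= lexx ltW.
have bab : b \in `[a, b] by rewrite in_itv/= lexx ltW.
have cth : {within `[a, b], continuous th}.
  apply: continuous_in_subspaceT => x /set_mem xab.
  by have [] := H x xab.
have FTC : (\int[@lebesgue_measure R]_(x in `[a, b]) (th x)%:E =
            (Th b)%:E - (Th a)%:E)%E.
  apply: continuous_FTC2 => //.
  - split.
    + by move=> x /inab xab; have [[]] := H x xab.
    + exact/cvg_at_right_filter/cTh.
    + exact/cvg_at_left_filter/cTh.
  - by move=> x /inab xab; rewrite derive1E; have [[]] := H x xab.
have : (\int[@lebesgue_measure R]_(x in `[a, b]) (phi x)%:E <=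
        \int[@lebesgue_measure R]_(x in `[a, b]) (th x)%:E)%E.
  apply: ge0_le_integral => //=.
  - by move=> x _; rewrite lee_fin.
  - exact/measurable_EFinP.
  - apply/measurable_EFinP; exact: subspace_continuous_measurable_fun.
  - by move=> x xab; rewrite lee_fin; have [] := H x xab.
move/le_trans; apply; rewrite FTC -EFinB lee_fin mulr2n.
have [_ _ ha _] := H a aab; have [_ _ hb _] := H b bab.
rewrite (le_trans (ler_norm _))// (le_trans (ler_normB _ _))//.
exact: lerD.
Qed.

End PrimitiveDominated.

(** * Derivatives of [x ^ n u(x)] and the mean square of the exponential sum *)

Section PowerPhase.
Variable R : realType.
Variables u u1 u2 : R -> R.

Definition phase (n : nat) (x : R) : R := x ^+ n * u x.
(** These are the formal derivatives of [phase], with [u1] and [u2] standing for [u'] and [u''].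
    Truncated predecessors in the exponents do no harm, since the coefficient in front is then 0. *)
Definition phase' (n : nat) (x : R) : R :=
  n%:R * x ^+ n.-1 * u x + x ^+ n * u1 x.
Definition phase'' (n : nat) (x : R) : R :=
  n%:R * n.-1%:R * x ^+ n.-2 * u x + 2 * n%:R * x ^+ n.-1 * u1 x
  + x ^+ n * u2 x.

Lemma is_derive_expr (n : nat) (x : R) :
  is_derive x 1 (fun x => x ^+ n) (n%:R * x ^+ n.-1).
Proof.
have -> : (fun x : R => x ^+ n) = id ^+ n.
  by apply/funext => y; rewrite exprfctE.
by apply: is_derive_eq; rewrite [LHS]mulr1.
Qed.

Lemma is_derive_phase (n : nat) (x : R) : is_derive x 1 u (u1 x) ->
  is_derive x 1 (phase n) (phase' n x).
Proof.
move=> du; have dX := is_derive_expr n x.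
apply: is_derive_eq (is_deriveM dX du) _.
by rewrite /phase' /GRing.scale /=; ring.
Qed.

Lemma is_derive_phase' (n : nat) (x : R) : is_derive x 1 u (u1 x) ->
  is_derive x 1 u1 (u2 x) -> is_derive x 1 (phase' n) (phase'' n x).
Proof.
move=> du du1; have dX := is_derive_expr n x.
have dX1 := is_derive_expr n.-1 x.
have H := is_deriveD (is_deriveZ n%:R (is_deriveM dX1 du)) (is_deriveM dX du1).
have E : n%:R \*: ((fun x => x ^+ n.-1) * u) + (fun x => x ^+ n) * u1 = phase' n.
  by apply/funext => y; rewrite /phase' -mulrA.
rewrite -E; apply: is_derive_eq H _; rewrite /phase'' /GRing.scale /=; ring.
Qed.

Lemma continuous_phase'' (n : nat) (x : R) : is_derive x 1 u (u1 x) ->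
  is_derive x 1 u1 (u2 x) -> {for x, continuous u2} ->
  {for x, continuous (phase'' n)}.
Proof.
move=> du du1 cu2.
have cu : {for x, continuous u}.
  by apply/differentiable_continuous/derivable1_diffP; case: du.
have cu1 : {for x, continuous u1}.
  by apply/differentiable_continuous/derivable1_diffP; case: du1.
have cX k : {for x, continuous (fun x : R => x ^+ k)}.
  exact: exprn_continuous.
have cc (k : R) : {for x, continuous (fun=> k)} by exact: cvg_cst.
apply: cvgD; last exact: cvgM (cX n) cu2.
apply: cvgD.
  exact: cvgM (cvgM (cc (n%:R * n.-1%:R)) (cX _)) cu.
exact: cvgM (cvgM (cc (2 * n%:R)) (cX _)) cu1.
Qed.

(** As [x >= 1], every power can be raised to [x ^ n]; the three terms then contribute [n ^ 2],
    [2 n] and [1], which add up to [(n + 1) ^ 2]. *)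
Lemma normr_phase''_le (n : nat) (x M : R) : 1 <= x -> `|u x| <= M ->
  `|u1 x| <= M -> `|u2 x| <= M -> `|phase'' n x| <= n.+1%:R ^+ 2 * M * x ^+ n.
Proof.
move=> x1 uM u1M u2M; have x0 : 0 <= x by lra.
have X k : (k <= n)%N -> 0 <= x ^+ k <= x ^+ n.
  by move=> kn; rewrite exprn_ge0//= ler_weXn2l.
have /andP[X0 Xn] := X n.-2 (leq_trans (leq_pred _) (leq_pred _)).
have /andP[Y0 Yn] := X n.-1 (leq_pred _).
have /andP[Z0 _] := X n (leqnn _).
have p0 : (0 : R) <= n%:R by [].
have p1 : (0 : R) <= n.-1%:R by [].
have p1n : (n.-1%:R : R) <= n%:R by rewrite ler_nat leq_pred.
rewrite [leRHS](_ : _ = n%:R * n%:R * x ^+ n * M + 2 * n%:R * x ^+ n * M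
  + x ^+ n * M); last by rewrite -natr1; ring.
rewrite /phase''.
apply: le_trans (ler_normD _ _) _; apply: lerD; last first.
  by rewrite normrM ger0_norm// ler_wpM2l.
apply: le_trans (ler_normD _ _) _; apply: lerD.
  rewrite normrM ler_pM// ger0_norm ?mulr_ge0//.
  by rewrite !ler_pM ?mulr_ge0.
rewrite normrM ler_pM// ger0_norm ?mulr_ge0//.
by rewrite ler_wpM2l// mulr_ge0.
Qed.

(** Multiplying by [x] turns [phase' k] into [x ^ k (k u + x u1)]. In the difference, the
    coefficient of [u] is at least [n x ^ (n - 1) (x - 1)] because [m < n], and the [u1] terms
    amount to at most [x M x ^ n]. *)
Lemma normr_phase'B_ge (m n : nat) (x c M : R) : (m < n)%N -> 1 <= x ->
  c <= `|u x| -> 0 < c -> `|u1 x| <= M ->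
  x ^+ n * (c * n%:R * (x - 1) / x ^+ 2 - M) <= `|phase' n x - phase' m x|.
Proof.
case: n => // n; rewrite ltnS => mn x1 cu c0 u1M.
have x0 : 0 < x by lra.
have xphase' k : x * phase' k x = x ^+ k * (k%:R * u x + x * u1 x).
  by case: k => [|k]; rewrite /phase' ?exprS/=; ring.
set X := x ^+ n; set Y := x ^+ m.
have Y0 : 0 <= Y by rewrite exprn_ge0// ltW.
have YX : Y <= X by rewrite ler_weXn2l.
have X0 : 0 <= X := le_trans Y0 YX.
have XxX : X <= x * X by rewrite ler_peMl.
rewrite -(ler_pM2l x0) -[X in _ <= X * _]ger0_norm ?(ltW x0)// -normrM.
rewrite [x * (phase' _ _ - _)]mulrBr !xphase' exprS -/X -/Y.
rewrite [X in _ <= `|X|](_ : _ =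
    u x * (n.+1%:R * x * X - m%:R * Y) - x * u1 x * (Y - x * X)); last by ring.
have mY : m%:R * Y <= n.+1%:R * X.
  by rewrite ler_pM// ler_nat leqW.
apply: le_trans (lerB_dist _ _).
rewrite [leLHS](_ : _ = c * (n.+1%:R * X * (x - 1)) - x * M * (x * X));
  last by field; rewrite gt_eqF.
apply: lerB.
  rewrite normrM ler_pM ?(ltW c0)//.
    by rewrite !mulr_ge0// subr_ge0.
  by apply: le_trans (ler_norm _); lra.
rewrite normrM ler_pM//.
  by rewrite normrM (ger0_norm (ltW x0)) ler_wpM2l// ltW.
by rewrite distrC ger0_norm; lra.
Qed.

Lemma cos_phaseB_dominated (a b c M : R) : 1 < a -> a < b -> 0 < c ->
  (forall x, x \in `[a, b] ->
    [/\ is_derive x 1 u (u1 x), is_derive x 1 u1 (u2 x) & {for x, continuous u2}]) ->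
  (forall x, x \in `[a, b] ->
    [/\ c <= `|u x|, `|u x| <= M, `|u1 x| <= M & `|u2 x| <= M]) ->
  exists2 K, 0 <= K & forall m n, (m < n)%N ->
    primitive_dominated a b (fun x => cos (phase n x - phase m x)) (K / n%:R).
Proof.
move=> a1 ab c0 Hd Hb.
have a0 : 0 < a by lra.
have b0 : 0 < b by lra.
have M0 : 0 <= M.
  have [|_ + _ _] := Hb a; first by rewrite in_itv/= lexx ltW.
  exact: le_trans.
(* [2 d] is the worst value on [[a, b]] of the coefficient [c (x - 1) / x ^ 2] of [n] in
   [normr_phase'B_ge]. Half of it is given up to absorb [M], which is possible once [n >= M / d]. *)
have [d dE] : {d | d = c * (a - 1) / b ^+ 2 / 2} by eexists.
have d0 : 0 < d by rewrite dE !divr_gt0 ?exprn_gt0// mulr_gt0 ?subr_gt0.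
(* Chosen so that [5 n ^ 2 M x ^ n <= (E / n) (d n x ^ n) ^ 2] reduces to the Bernoulli inequality
   [n (a - 1) <= x ^ n]. *)
have [E EE] : {E | E = 5 * M / (d ^+ 2 * (a - 1))} by eexists.
have E0 : 0 <= E.
  by rewrite EE divr_ge0// mulr_ge0 ?exprn_ge0 ?subr_ge0 ?(ltW a1) ?(ltW d0).
have Md0 : 0 <= M / d by rewrite divr_ge0 ?(ltW d0).
pose n0 := Num.bound (M / d).
exists (d^-1 + E * b + n0%:R * b).
  by rewrite !addr_ge0 ?mulr_ge0 ?invr_ge0 ?(ltW b0) ?(ltW d0).
move=> m n mn.
have n_gt0 : (0 : R) < n%:R by rewrite ltr0n (leq_ltn_trans _ mn).
(* For [n < n0] the trivial bound [cos <= 1] costs [b <= n0 b / n], whence the last summand of the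
   constant. *)
case: (ltnP n n0) => [nn0|n0n].
  have := @primitive_dominated_cst R a b 1 (ltW a0) ler01.
  apply: primitive_dominatedW; first by move=> x _; exact: cos_le1.
  rewrite mul1r ler_pdivlMr// mulrC -[leLHS]add0r lerD//.
    by rewrite addr_ge0 ?mulr_ge0 ?invr_ge0 ?(ltW b0) ?(ltW d0).
  by rewrite ler_wpM2r ?(ltW b0)// ler_nat ltnW.
have Mn : M <= d * n%:R.
  rewrite mulrC -ler_pdivrMr// (le_trans (ltW (archi_boundP Md0)))//.
  by rewrite ler_nat.
apply: (@primitive_dominatedW _ _ _
  (fun x => cos (phase n x - phase m x)) _ ((d * n%:R)^-1 + E / n%:R * b)) => //.
  rewrite invfM mulrAC -mulrDl ler_wpM2r ?invr_ge0 ?(ltW n_gt0)// lerDl.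
  by rewrite mulr_ge0 ?(ltW b0).
apply: (@primitive_dominated_cos _ _ _ _ (fun x => phase' n x - phase' m x)
  (fun x => phase'' n x - phase'' m x)) => //.
- exact: ltW.
- by rewrite mulr_gt0.
- by rewrite divr_ge0// ltW.
move=> x xab; have [du du1 cu2] := Hd x xab.
have [cu uM u1M u2M] := Hb x xab.
have /andP[ax xb] : a <= x <= b by rewrite in_itv in xab.
have x1 : 1 <= x by lra.
have x0 : 0 < x by lra.
have xn0 : 0 < x ^+ n by rewrite exprn_gt0.
have lb : x ^+ n * (d * n%:R) <= `|phase' n x - phase' m x|.
  apply: le_trans (normr_phase'B_ge mn x1 cu c0 u1M).
  rewrite ler_wpM2l ?(ltW xn0)//.
  have : 2 * d * n%:R <= c * n%:R * (x - 1) / x ^+ 2.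
    rewrite [leLHS](_ : _ = c * n%:R * (a - 1) / b ^+ 2); last first.
      by rewrite dE; field; rewrite gt_eqF.
    have cn : 0 <= c * n%:R by rewrite mulr_ge0 ?ltW.
    rewrite ler_pM ?invr_ge0 ?exprn_ge0 ?(ltW b0)//.
    - by rewrite mulr_ge0// subr_ge0 ltW.
    - by rewrite ler_wpM2l// lerD2r.
    - by rewrite lef_pV2 ?posrE ?exprn_gt0// ler_pXn2r ?nnegrE ?(ltW x0) ?(ltW b0).
  by lra.
split.
- exact: is_deriveB (is_derive_phase n du) (is_derive_phase m du).
- exact: is_deriveB (is_derive_phase' n du du1) (is_derive_phase' m du du1).
- by apply: cvgB; exact: continuous_phase''.
- apply: le_trans lb; rewrite ler_peMl ?mulr_ge0 ?(ltW d0)//.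
  by rewrite exprn_ege1.
(* The constant 5 is [4 + 1]: [(n + 1) ^ 2 <= 4 n ^ 2] since [n >= 1], and [(m + 1) ^ 2 <= n ^ 2]
   since [m < n]. *)
- have ub : `|phase'' n x - phase'' m x| <= 5 * n%:R ^+ 2 * M * x ^+ n.
    apply: le_trans (ler_normB _ _) _.
    apply: le_trans (lerD (normr_phase''_le n x1 uM u1M u2M)
                          (normr_phase''_le m x1 uM u1M u2M)) _.
    rewrite [leRHS](_ : _ = 4 * n%:R ^+ 2 * M * x ^+ n + n%:R ^+ 2 * M * x ^+ n);
      last by ring.
    apply: lerD.
      rewrite ler_wpM2r ?(ltW xn0)// ler_wpM2r//.
      rewrite -[4](_ : 2 ^+ 2 = _); last by ring.
      rewrite -exprMn ler_pXn2r ?nnegrE ?mulr_ge0//.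
      by rewrite -natrM ler_nat mul2n -addnn -addn1 leq_add2l (leq_ltn_trans _ mn).
    rewrite ler_pM ?mulr_ge0 ?exprn_ge0 ?(ltW x0)//.
      by rewrite ler_wpM2r// ler_pXn2r ?nnegrE// ler_nat.
    by rewrite ler_weXn2l// ltnW.
  apply: le_trans ub _.
  rewrite -[X in _ <= _ * X]real_normK ?num_real//.
  have bern : n%:R * (a - 1) <= x ^+ n.
    apply: (@le_trans _ _ (n%:R * (x - 1))); first by rewrite ler_wpM2l//; lra.
    have -> : x ^+ n = (1 + (x - 1)) ^+ n by congr (_ ^+ n); ring.
    elim: (n) => [|k IHk]; first by rewrite mul0r expr0 ler01.
    rewrite -natr1 exprS mulrDl mul1r.
    have : 1 <= (1 + (x - 1)) ^+ k by rewrite exprn_ege1//; lra.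
    by nra.
  have E2 : E / n%:R * (x ^+ n * (d * n%:R)) ^+ 2
      <= E / n%:R * `|phase' n x - phase' m x| ^+ 2.
    rewrite ler_wpM2l ?divr_ge0//.
    by rewrite ler_pXn2r ?nnegrE// !mulr_ge0 ?(ltW xn0) ?(ltW d0).
  apply: le_trans E2.
  have a1_neq0 : a - 1 != 0 by rewrite subr_eq0 gt_eqF.
  rewrite [leRHS](_ : _ = (5 * n%:R * M * x ^+ n / (a - 1)) * x ^+ n); last first.
    by rewrite EE; field; rewrite !gt_eqF// subr_gt0.
  apply: le_trans (_ : _ <= (5 * n%:R * M * x ^+ n / (a - 1)) * (n%:R * (a - 1))) _.
    rewrite le_eqVlt; apply/orP; left; apply/eqP; field.
    by rewrite a1_neq0.
  by rewrite ler_wpM2l// divr_ge0 ?mulr_ge0 ?(ltW xn0)// subr_ge0 ltW.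
Qed.

(** The squared modulus of the sum of [e^{i phase n x}] over [n < N], in real terms. *)
Definition phase_sum2 (N : nat) (x : R) : R :=
  (\sum_(n < N) cos (phase n x)) ^+ 2 + (\sum_(n < N) sin (phase n x)) ^+ 2.

Lemma phase_sum2S (N : nat) (x : R) : phase_sum2 N.+1 x =
  phase_sum2 N x + (1 + 2 * \sum_(m < N) cos (phase N x - phase m x)).
Proof.
rewrite /phase_sum2 !big_ord_recr/=.
under [X in _ + (1 + 2 * X)]eq_bigr do rewrite cosB.
rewrite big_split/= -!mulr_sumr.
set A := \sum_(i < N) cos _; set B := \sum_(i < N) sin _.
have := cos2Dsin2 (phase N x).
set p := cos _; set q := sin _ => pq.
by rewrite -[X in _ + (X + _)]pq; ring.
Qed.

(** Passing from [N] to [N + 1] adds a diagonal term 1, of cost [b], and twice [N] cross terms of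
    cost [K / N] each. The increment is thus bounded independently of [N], and the total grows
    linearly. *)
Lemma phase_sum2_dominated (a b c M : R) : 1 < a -> a < b -> 0 < c ->
  (forall x, x \in `[a, b] ->
    [/\ is_derive x 1 u (u1 x), is_derive x 1 u1 (u2 x) & {for x, continuous u2}]) ->
  (forall x, x \in `[a, b] ->
    [/\ c <= `|u x|, `|u x| <= M, `|u1 x| <= M & `|u2 x| <= M]) ->
  exists2 K, 0 <= K & forall N,
    primitive_dominated a b (phase_sum2 N) (K * N%:R).
Proof.
move=> a1 ab c0 Hd Hb.
have [K K0 HK] := cos_phaseB_dominated a1 ab c0 Hd Hb.
have a0 : 0 <= a by lra.
exists (b + K * 2); first by rewrite addr_ge0 ?mulr_ge0//; lra.
elim=> [|N IHN].
  have := @primitive_dominated_cst _ a b 0 a0 (lexx _).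
  apply: primitive_dominatedW => [x _|]; last by rewrite mul0r mulr0.
  by rewrite /phase_sum2 !big_ord0 expr0n addr0.
have dsum := @primitive_dominated_sum _ a b N _ (K / N%:R) a0 (fun m mN => HK m N mN).
have d1 := @primitive_dominated_cst _ a b 1 a0 ler01.
have := primitive_dominatedD IHN (primitive_dominatedD d1 (primitive_dominatedD dsum dsum)).
apply: primitive_dominatedW => [x _|].
  by rewrite phase_sum2S mulr_natl mulr2n.
rewrite -[N.+1%:R]natr1 [leRHS]mulrDr lerD2l mul1r mulr1 lerD2l.
have : N%:R * (K / N%:R) <= K.
  have [->|N0] := posnP N; first by rewrite mul0r.
  by rewrite mulrCA divff ?mulr1// pnatr_eq0 -lt0n.
by lra.
Qed.

End PowerPhase.

(** * Summable series, almost everywhere convergence and interpolation between squares *)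

Lemma nneseries_cvg0 (R : realType) (f : nat -> \bar R) :
  (forall k, 0 <= f k)%E -> (\sum_(k <oo) f k < +oo)%E -> f @ \oo --> (0 : \bar R)%E.
Proof.
move=> f0 foo.
have tail := nneseries_tail_cvg foo (fun k _ => f0 k).
apply: squeeze_cvge tail; last exact: cvg_cst.
apply: nearW => N; rewrite f0/=.
have := @nneseries_lim_ge R f xpredT N N.+1 (fun n _ _ => f0 n).
by rewrite big_nat1.
Qed.

(** Exchanging sum and integral makes the sum of the [phi k] integrable, hence finite almost
    everywhere; where it is finite, its terms tend to 0. *)
Lemma ae_cvg0_integral d (T : measurableType d) (R : realType)
    (mu : {measure set T -> \bar R}) (D : set T) (phi : nat -> T -> R) :
  measurable D -> (forall k, measurable_fun D (phi k)) ->
  (forall k x, 0 <= phi k x) ->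
  (\sum_(k <oo) \int[mu]_(x in D) (phi k x)%:E < +oo)%E ->
  {ae mu, forall x, D x -> phi k x @[k --> \oo] --> (0 : R)}.
Proof.
move=> mD mphi phi0 sumoo.
have mphiE k : measurable_fun D (EFin \o phi k) by exact/measurable_EFinP.
have phi0E k x : D x -> (0 <= (EFin \o phi k) x)%E by rewrite lee_fin.
pose S x := (\sum_(k <oo) (phi k x)%:E)%E.
have S0 x : (0 <= S x)%E by apply: nneseries_ge0 => k _ _; rewrite lee_fin.
have iS : mu.-integrable D S.
  apply/integrableP; split.
    apply: (@ge0_emeasurable_sum _ _ _ D (fun k => EFin \o phi k) xpredT) => //.
    by move=> k x Dx _; exact: phi0E.
  under eq_integral do rewrite gee0_abs//.
  by rewrite /S integral_nneseries.
have := integrable_ae mD iS; apply: filterS => x finS Dx.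
suff /fine_cvg : (phi k x)%:E @[k --> \oo] --> (0 : \bar R)%E by [].
apply: nneseries_cvg0; first by move=> k; rewrite lee_fin.
by rewrite ltey; move: (finS Dx); rewrite fin_numE => /andP[].
Qed.

Lemma nneseries_inv_sqr (R : realType) (C : R) : 0 <= C ->
  (\sum_(k <oo) (C / k.+1%:R ^+ 2)%:E < +oo)%E.
Proof.
move=> C0.
apply: (@le_lt_trans _ _ (2 * C)%:E); last exact: ltry.
apply: lime_le.
  by apply: is_cvg_nneseries => k _ _; rewrite lee_fin divr_ge0 ?exprn_ge0.
apply: nearW => N; rewrite sumEFin lee_fin.
(* Telescoping bound, from [1 / p ^ 2 <= 2 / p - 2 / (p + 1)] for [p >= 1]. *)
suff : \sum_(0 <= k < N) C / k.+1%:R ^+ 2 <= 2 * C - 2 * C / N.+1%:R.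
  by move/le_trans; apply; rewrite gerBl divr_ge0// mulr_ge0.
elim: N => [|N IHN]; first by rewrite big_geq// divr1 subrr.
rewrite big_nat_recr//=; apply: le_trans (lerD IHN (lexx _)) _.
have p0 : 0 < N.+1%:R :> R by [].
rewrite -[N.+2%:R]natr1; move: p0; set p := N.+1%:R => p0.
have p1 : 1 <= p by rewrite /p ler1n.
rewrite -subr_ge0.
rewrite [X in 0 <= X](_ : _ = C * (p - 1) / (p ^+ 2 * (p + 1))).
  rewrite divr_ge0 ?mulr_ge0 ?subr_ge0 ?exprn_ge0 ?addr_ge0 ?(ltW p0)//.
by field; rewrite !gt_eqF// addr_gt0.
Qed.

Lemma nat_sqr_between (N : nat) : exists k : nat, (k ^ 2 <= N < k.+1 ^ 2)%N.
Proof.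
elim: N => [|N [k /andP[kN Nk]]]; first by exists 0%N.
have [Nk'|kN'] := ltnP N.+1 (k.+1 ^ 2); first by exists k; rewrite Nk' ltnW.
exists k.+1; rewrite kN'/= (leq_ltn_trans Nk)//.
by rewrite ltn_exp2r.
Qed.

(** For [k ^ 2 <= N < (k + 1) ^ 2] the value [s N] differs from [s (k ^ 2)] by at most [2 k], which
    is negligible against [N >= k ^ 2]. *)
Lemma cvg0_avg_of_sqr (R : realType) (s : nat -> R) : s 0%N = 0 ->
  (forall n, `|s n.+1 - s n| <= 1) ->
  s (k.+1 ^ 2)%N / (k.+1 ^ 2)%:R @[k --> \oo] --> (0 : R) ->
  s N / N%:R @[N --> \oo] --> (0 : R).
Proof.
move=> s0 sS sk.
have sD n m : `|s (n + m)%N - s n| <= m%:R.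
  elim: m => [|m IHm]; first by rewrite addn0 subrr normr0.
  rewrite addnS -natr1 -(subrKA (s (n + m)%N)) addrC.
  by rewrite (le_trans (ler_normD _ _))// lerD.
apply/cvgr0Pnorm_le => e e0.
have e20 : 0 < e / 2 by rewrite divr_gt0.
move/cvgr0Pnorm_le/(_ _ e20) : sk => [k0 _ Hk0].
(* The successor allows the hypothesis to be used at [k.-1], where it concerns [k ^ 2]; the bound
   [4 / e] makes the gap [2 k] at most [(e / 2) k ^ 2]. *)
pose k1 := maxn k0.+1 (Num.bound (4 / e)).
exists (k1 ^ 2)%N => //= N /= k1N.
have [k /andP[kN Nk]] := nat_sqr_between N.
have k1k : (k1 <= k)%N.
  by rewrite -ltnS -(@ltn_exp2r _ _ 2)// (leq_ltn_trans k1N Nk).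
have k0k : (k0 < k)%N by rewrite (leq_trans _ k1k)// leq_maxl.
have k_gt0 : (0 < k)%N by rewrite (leq_ltn_trans _ k0k).
have ek : 4 <= e * k%:R.
  rewrite mulrC -ler_pdivrMr//.
  have /archi_boundP/ltW/le_trans -> // : 0 <= 4 / e by rewrite divr_ge0// ltW.
  by rewrite ler_nat (leq_trans _ k1k)// leq_maxr.
have N0 : 0 < N%:R :> R by rewrite ltr0n (leq_trans _ kN)// expn_gt0 k_gt0.
have kR0 : 0 < k%:R :> R by rewrite ltr0n.
rewrite normrM normfV [`|N%:R|]ger0_norm// ler_pdivrMr//.
have sk : `|s (k ^ 2)%N| <= e / 2 * k%:R ^+ 2.
  have := Hk0 k.-1; rewrite prednK//= -ltnS prednK// => /(_ k0k).
  rewrite normrM normfV natrX [`|_ ^+ 2|]ger0_norm ?exprn_ge0//.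
  by rewrite ler_pdivrMr// exprn_gt0.
have kNR : k%:R ^+ 2 <= N%:R :> R by rewrite -natrX ler_nat.
have d2k : (N - k ^ 2)%:R <= 2 * k%:R :> R.
  rewrite -natrM ler_nat leq_subLR -ltnS (leq_trans Nk)//.
  by rewrite -addn1 sqrnD exp1n muln1 addnAC addn1.
have := sD (k ^ 2)%N (N - k ^ 2)%N; rewrite subnKC// => dN.
rewrite -[s N](subrK (s (k ^ 2)%N)) (le_trans (ler_normD _ _))//.
have : 2 * k%:R <= e / 2 * k%:R ^+ 2.
  rewrite [leRHS](_ : _ = e * k%:R / 2 * k%:R); last by ring.
  by rewrite ler_pM2r//; lra.
have : e * k%:R ^+ 2 <= e * N%:R by rewrite ler_pM2l.
by lra.
Qed.

(** * Vanishing of exponential means for almost every base *)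

Section Equidistribution.
Variable R : realType.

#[local] Instance ae_lebesgue_filter :
  Filter (nbhs (almost_everywhere (@lebesgue_measure R))).
Proof. exact: (ae_filter_ringOfSetsType (@lebesgue_measure R)). Qed.

(** Expresses that [e^{i t n}] has mean 0. Splitting into coordinates keeps the analysis in [R];
    [cvg0_cis_mean] returns to [R[i]]. *)
Definition cis_mean0 (t : nat -> R) : Prop :=
  (\sum_(n < N) cos (t n)) / N%:R @[N --> \oo] --> (0 : R) /\
  (\sum_(n < N) sin (t n)) / N%:R @[N --> \oo] --> (0 : R).

(** Each coordinate of the sum is bounded by its modulus and moves by at most 1 per step, so
    [cvg0_avg_of_sqr] applies to both. *)
Lemma cis_mean0_of_sqr (t : nat -> R) :
  ((\sum_(n < k.+1 ^ 2) cos (t n)) ^+ 2 + (\sum_(n < k.+1 ^ 2) sin (t n)) ^+ 2)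
    / (k.+1 ^ 2)%:R ^+ 2 @[k --> \oo] --> (0 : R) -> cis_mean0 t.
Proof.
move=> H.
have aux (v w : nat -> R) (p : nat -> R) : (forall n, `|p n| <= 1) ->
    (forall N, v N = \sum_(n < N) p n) ->
    (v (k.+1 ^ 2)%N ^+ 2 + w (k.+1 ^ 2)%N ^+ 2) / (k.+1 ^ 2)%:R ^+ 2
      @[k --> \oo] --> (0 : R) ->
    v N / N%:R @[N --> \oo] --> (0 : R).
  move=> p1 vE /cvgr0Pnorm_lt vw; apply: cvg0_avg_of_sqr.
  - by rewrite vE big_ord0.
  - by move=> n; rewrite !vE big_ord_recr/= addrAC subrr add0r.
  apply/cvgr0Pnorm_lt => e e0.
  have := vw _ (exprn_gt0 2 e0); apply: filterS => k.
  rewrite ger0_norm ?divr_ge0 ?addr_ge0 ?sqr_ge0// => vwe.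
  rewrite -(@ltr_pXn2r _ 2) ?nnegrE ?(ltW e0)//.
  apply: le_lt_trans vwe.
  rewrite real_normK ?num_real// exprMn exprVn.
  by rewrite ler_wpM2r ?invr_ge0 ?sqr_ge0// lerDl sqr_ge0.
split.
- apply: (aux _ (fun N => \sum_(n < N) sin (t n)) (cos \o t)) => // n.
  by rewrite ler_norml cos_geN1 cos_le1.
- apply: (aux _ (fun N => \sum_(n < N) cos (t n)) (sin \o t)) => // [n|].
    by rewrite ler_norml sin_geN1 sin_le1.
  by under eq_fun do rewrite addrC.
Qed.

Variables u u1 u2 : R -> R.

Lemma measurable_phase_sum2 (D : set R) N : measurable_fun D u ->
  measurable_fun D (phase_sum2 u N).
Proof.
move=> mu.
have mph n : measurable_fun D (phase u n).
  by apply: measurable_funM => //; apply: measurable_funX.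
apply: measurable_funD; apply: measurable_funX.
- apply: measurable_sum => n; apply: measurableT_comp => //.
  exact: continuous_measurable_fun (@continuous_cos R).
- apply: measurable_sum => n; apply: measurableT_comp => //.
  exact: continuous_measurable_fun (@continuous_sin R).
Qed.

(** The normalised square modulus at [N = (k + 1) ^ 2] has integral at most
    [2 K N / N ^ 2 = 2 K / (k + 1) ^ 2], which is summable over [k]. *)
Lemma ae_cis_mean0_itv (a b c M : R) : 1 < a -> a < b -> 0 < c ->
  (forall x, x \in `[a, b] ->
    [/\ is_derive x 1 u (u1 x), is_derive x 1 u1 (u2 x) & {for x, continuous u2}]) ->
  (forall x, x \in `[a, b] ->
    [/\ c <= `|u x|, `|u x| <= M, `|u1 x| <= M & `|u2 x| <= M]) ->
  {ae (@lebesgue_measure R), forall x, x \in `[a, b] ->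
    cis_mean0 (fun n => x ^+ n * u x)}.
Proof.
move=> a1 ab c0 Hd Hb.
have [K K0 HK] := phase_sum2_dominated a1 ab c0 Hd Hb.
have cu : {within `[a, b], continuous u}.
  apply: continuous_in_subspaceT => x /set_mem xab.
  apply/differentiable_continuous/derivable1_diffP.
  by have [[]] := Hd x xab.
have mu : measurable_fun `[a, b] u by exact: subspace_continuous_measurable_fun.
have S0 N x : 0 <= phase_sum2 u N x by rewrite addr_ge0 ?sqr_ge0.
pose phi (k : nat) x := phase_sum2 u (k.+1 ^ 2)%N x / (k.+1 ^ 2)%:R ^+ 2.
have : {ae (@lebesgue_measure R), forall x, [set` `[a, b]] x ->
    phi k x @[k --> \oo] --> (0 : R)}.
  apply: ae_cvg0_integral => //.
  - move=> k; apply: measurable_funM => //; exact: measurable_phase_sum2.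
  - by move=> k x; rewrite divr_ge0 ?exprn_ge0.
  have K20 : 0 <= K *+ 2 by rewrite mulrn_wge0.
  apply: le_lt_trans (nneseries_inv_sqr K20).
  apply: lee_nneseries => [k _ _|k _].
    by apply: integral_ge0 => x _; rewrite lee_fin divr_ge0 ?exprn_ge0.
  have k0 : 0 < (k.+1 ^ 2)%:R :> R by rewrite ltr0n expn_gt0.
  have k20 : 0 <= ((k.+1 ^ 2)%:R ^+ 2)^-1 :> R by rewrite invr_ge0 exprn_ge0// ltW.
  rewrite /phi; under eq_integral do rewrite mulrC EFinM.
  rewrite ge0_integralZl_EFin//.
  - apply: le_trans (lee_wpmul2l _ (primitive_dominated_integral ab (S0 _)
      (measurable_phase_sum2 _ mu) (HK _))) _.
      by rewrite lee_fin.
    rewrite -EFinM lee_fin le_eqVlt; apply/orP; left; apply/eqP.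
    by rewrite natrX; field; rewrite nat1r pnatr_eq0.
  - by move=> x _; rewrite lee_fin.
  - by apply/measurable_EFinP; exact: measurable_phase_sum2.
apply: filterS => x H xab; apply: cis_mean0_of_sqr.
exact: H.
Qed.

Lemma ae_forall_countable (I : countType) (P : I -> R -> Prop) :
  (forall i, {ae (@lebesgue_measure R), forall x, P i x}) ->
  {ae (@lebesgue_measure R), forall x, forall i, P i x}.
Proof.
move=> H.
have := @ae_foralln _ _ _ (@lebesgue_measure R)
  (fun n x => if unpickle n is Some i then P i x else True).
have Hn n : {ae (@lebesgue_measure R), forall x,
    if unpickle n is Some i then P i x else True}.
  by case: (unpickle n) => [i|]; [exact: H|exact: aeW].
move/(_ Hn); apply: filterS => x Hx i.
by have := Hx (pickle i); rewrite pickleK.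
Qed.

(** The points with [u x != 0] are covered by countably many compact intervals to which
    [ae_cis_mean0_itv] applies, and the remaining points form a countable, hence null, set. *)
Lemma ae_cis_mean0 :
  (forall x : R, 1 < x ->
    [/\ is_derive x 1 u (u1 x), is_derive x 1 u1 (u2 x) & {for x, continuous u2}]) ->
  countable [set x | 1 < x /\ u x = 0] ->
  {ae (@lebesgue_measure R), forall x, 1 < x ->
    cis_mean0 (fun n => x ^+ n * u x)}.
Proof.
move=> Hd Z0.
(* Rational endpoints and a single natural number for all bounds keep the family countable. The
   successor in the lower bound keeps it positive. *)
pose good (q : rat * rat * nat) := forall x : R, x \in `[ratr q.1.1, ratr q.1.2] ->
  [/\ q.2.+1%:R^-1 <= `|u x|, `|u x| <= q.2%:R, `|u1 x| <= q.2%:R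
    & `|u2 x| <= q.2%:R].
have ae_good : {ae (@lebesgue_measure R), forall x, forall q : rat * rat * nat,
    1 < ratr q.1.1 :> R -> ratr q.1.1 < ratr q.1.2 :> R -> good q ->
    x \in `[ratr q.1.1, ratr q.1.2] -> cis_mean0 (fun n => x ^+ n * u x)}.
  apply: ae_forall_countable => q.
  have [[a1 ab gq]|ngood] := pselect
      [/\ 1 < ratr q.1.1 :> R, ratr q.1.1 < ratr q.1.2 :> R & good q].
    have qd (x : R) : x \in `[ratr q.1.1, ratr q.1.2] ->
        [/\ is_derive x 1 u (u1 x), is_derive x 1 u1 (u2 x) & {for x, continuous u2}].
      by rewrite in_itv => /andP[ax _]; apply: Hd; exact: lt_le_trans ax.
    have q0 : 0 < q.2.+1%:R^-1 :> R by rewrite invr_gt0.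
    by have := ae_cis_mean0_itv a1 ab q0 qd gq; apply: filterS => x Hx _ _ _ /Hx.
  by apply: aeW => x a1 ab gq; case: ngood.
have ae_nz : {ae (@lebesgue_measure R), forall x, ~ (1 < x /\ u x = 0)}.
  apply: negligibleS (_ : (@lebesgue_measure R).-negligible [set x | 1 < x /\ u x = 0]).
    by move=> x /= /contrapT.
  apply/negligibleP; last exact: countable_lebesgue_measure0.
  exact: countable_measurable.
have loc (x : R) : 1 < x -> u x != 0 -> exists q, [/\ 1 < ratr q.1.1 :> R,
    ratr q.1.1 < ratr q.1.2 :> R, good q & x \in `[ratr q.1.1, ratr q.1.2]].
  move=> x1 ux0.
  have [du du1 cu2] := Hd x x1.
  have cu : {for x, continuous u}.
    by apply/differentiable_continuous/derivable1_diffP; case: du.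
  have cu1 : {for x, continuous u1}.
    by apply/differentiable_continuous/derivable1_diffP; case: du1.
  (* Including the inverse of [|u x|] lets one integer above [B] provide both the lower and the
     upper bounds at [x], strictly, so that they persist nearby. *)
  pose B := `|u x|^-1 + `|u x| + `|u1 x| + `|u2 x| + 1.
  have B0 : 0 <= B by rewrite !addr_ge0 ?invr_ge0.
  pose k := Num.bound B.
  have Bk : B < k%:R by exact: archi_boundP.
  have n0 := normr_ge0 (u x); have n1 := normr_ge0 (u1 x); have n2 := normr_ge0 (u2 x).
  have n3 : 0 < `|u x|^-1 by rewrite invr_gt0 normr_gt0.
  have lk : k.+1%:R^-1 < `|u x|.
    rewrite -[ltRHS]invrK ltf_pV2 ?posrE// -natr1; rewrite /B in Bk; lra.
  have bk0 : `|u x| < k%:R by rewrite /B in Bk; lra.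
  have bk1 : `|u1 x| < k%:R by rewrite /B in Bk; lra.
  have bk2 : `|u2 x| < k%:R by rewrite /B in Bk; lra.
  have : \forall y \near x, [/\ k.+1%:R^-1 <= `|u y|, `|u y| <= k%:R,
      `|u1 y| <= k%:R & `|u2 y| <= k%:R] /\ 1 < y.
    near=> y; do ?split.
    - by apply: ltW; near: y; exact: (cvgr_norm_gt (u x)).
    - by apply: ltW; near: y; exact: (cvgr_norm_lt (u x)).
    - by apply: ltW; near: y; exact: (cvgr_norm_lt (u1 x)).
    - by apply: ltW; near: y; exact: (cvgr_norm_lt (u2 x)).
    - by near: y; exact: lt_nbhsr.
  move=> /nbhs_ballP[e /= e0 He].
  have /rat_in_itvoo[p /[!in_itv]/= /andP[p1 p2]] : x - e < x by lra.
  have /rat_in_itvoo[q /[!in_itv]/= /andP[q1 q2]] : x < x + e by lra.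
  have inb (y : R) : ratr p <= y <= ratr q -> ball x e y.
    by move=> /andP[py yq]; rewrite /ball/= ltr_norml; lra.
  exists (p, q, k); split => /=.
  - by apply: (He (ratr p) _).2; apply: inb; lra.
  - by lra.
  - by move=> y; rewrite in_itv/= => /inb /He[].
  - by rewrite in_itv/=; lra.
apply: filterS2 ae_good ae_nz => x Hx nz x1.
have [|q [q1 q12 gq xq]] := loc x x1; first by apply/eqP => ux0; apply: nz.
exact: Hx q1 q12 gq xq.
Unshelve. all: by end_near. Qed.

End Equidistribution.

(** * The character [e^{2 pi i t}] and complex means *)

Section Cis.
Local Open Scope complex_scope.
Variable R : realType.
Implicit Types s t : R.

Lemma cis2piE t : cis2pi t = cos (2 * pi * t) +i* sin (2 * pi * t).
Proof. by []. Qed.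

Lemma cis2pi0 : cis2pi (0 : R) = 1.
Proof. by rewrite cis2piE mulr0 cos0 sin0. Qed.

Lemma cis2piD s t : cis2pi (s + t) = cis2pi s * cis2pi t.
Proof.
rewrite !cis2piE mulrDr cosD sinD; simpc.
by apply/eqP; rewrite eq_complex/= eqxx/= addrC.
Qed.

Lemma cis2pi_neq0 t : cis2pi t != 0.
Proof.
apply/eqP => t0; have := cis2piD t (- t); rewrite t0 mul0r subrr cis2pi0.
by move/eqP; rewrite oner_eq0.
Qed.

Lemma cis2piN t : cis2pi (- t) = (cis2pi t)^-1.
Proof.
apply: (mulfI (cis2pi_neq0 t)); rewrite -cis2piD subrr cis2pi0 mulfV//.
exact: cis2pi_neq0.
Qed.

Lemma cis2pi_sum (I : Type) (r : seq I) (P : pred I) (F : I -> R) :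
  cis2pi (\sum_(i <- r | P i) F i) = \prod_(i <- r | P i) cis2pi (F i).
Proof. exact: (big_morph _ cis2piD cis2pi0). Qed.

Lemma cis2pi_mulrz (n : int) t : cis2pi (n%:~R * t) = cis2pi t ^ n.
Proof.
have nat_case m : cis2pi (m%:R * t) = cis2pi t ^+ m.
  elim: m => [|m IHm]; first by rewrite mul0r cis2pi0.
  by rewrite -natr1 mulrDl mul1r cis2piD IHm exprSr.
case: n => n; first exact: nat_case.
by rewrite NegzE mulrNz mulNr cis2piN nat_case.
Qed.

Lemma normr_cis2pi t : `|cis2pi t| = 1.
Proof. by rewrite normc_def/= cos2Dsin2 sqrtr1. Qed.

Lemma cis2pi1 : cis2pi (1 : R) = 1.
Proof. by rewrite cis2piE mulr1 mulr_natl cos2pi sin2pi. Qed.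

Lemma power_cis2pi t (n : int) : power (cis2pi t) n = cis2pi (n%:~R * t).
Proof. by rewrite /power (negbTE (cis2pi_neq0 t)) cis2pi_mulrz. Qed.

Lemma cvg0_cis_mean (t : nat -> R) : cis_mean0 t ->
  ((\sum_(n < N) (cos (t n) +i* sin (t n))) / N%:R : R[i]^o) @[N --> \oo]
    --> (0 : R[i]^o).
Proof.
move=> [/cvgr0Pnorm_lt cC /cvgr0Pnorm_lt cS]; apply/cvgr0Pnorm_lt => e e0.
(* In [R[i]] a positive tolerance is necessarily real, so it can be halved between the two
   coordinates. *)
have eE : e = (complex.Re e)%:C by rewrite RRe_real// gtr0_real.
have e20 : 0 < complex.Re e / 2 by rewrite divr_gt0// -ltcR -eE.
pose A N := \sum_(n < N) cos (t n); pose B N := \sum_(n < N) sin (t n).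
near=> N.
have -> : (\sum_(n < N) (cos (t n) +i* sin (t n))) / N%:R =
    (A N / N%:R)%:C + 'i%C * (B N / N%:R)%:C :> R[i].
  have -> : \sum_(n < N) (cos (t n) +i* sin (t n)) = (A N)%:C + 'i%C * (B N)%:C.
    rewrite !rmorph_sum mulr_sumr -big_split/=.
    by apply: eq_bigr => n _; rewrite [LHS]complexE.
  by rewrite mulrDl !rmorphM/= !fmorphV/= rmorph_nat mulrA.
have norm_real (x : R) : `|x%:C| = `|x|%:C.
  by rewrite normc_def/= expr0n/= addr0 sqrtr_sqr.
have normi : `|'i%C : R[i]| = 1.
  by rewrite normc_def/= expr0n/= add0r expr1n sqrtr1.
apply: (@le_lt_trans _ _ (`|A N / N%:R| + `|B N / N%:R|)%:C).
  rewrite rmorphD/= -!norm_real.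
  by apply: le_trans (ler_normD _ _) _; rewrite normrM normi mul1r.
rewrite eE ltcR [complex.Re e]splitr ltrD//; near: N; [exact: (cC (_ / 2))|exact: (cS (_ / 2))].
Unshelve. all: by end_near. Qed.

End Cis.

(** * From vanishing means to the Chowla property *)

Section ChowlaOrbit.
Local Open Scope complex_scope.
Variable R : realType.
Variables beta gb : R.

Let z (n : nat) : R[i] := cis2pi (beta ^+ n * gb).

Hypothesis mean0 : forall p : {poly int}, p != 0 ->
  cis_mean0 (fun n => beta ^+ n * (2 * pi * (map_poly intr p).[beta] * gb)).

(** The constant polynomial [k] says that [z ^ k] has mean 0, whereas [z n ^ k = 1] whenever [z n]
    is a [k]-th root of unity. Concentration on these roots would force the mean to be 1. *)
Lemma not_concentrated (k : nat) : (1 < k)%N -> ~ concentrated z (Some k).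
Proof.
move=> k1; rewrite /concentrated; set A := [set n | _] => zA.
have k0 : (k%:Z%:P : {poly int}) != 0 by rewrite polyC_eq0; case: (k) k1.
pose t n := beta ^+ n * (2 * pi * (map_poly intr k%:Z%:P).[beta] * gb).
have [t0 _] : cis_mean0 t := mean0 k0.
have tA n : ~ A n -> cos (t n) = 1.
  move=> /contrapT zn; have {zn} [j jk zj] : mu_group (Some k) (z n).
    by case: zn => // zn0; have := cis2pi_neq0 (beta ^+ n * gb); rewrite -/(z n) zn0 eqxx.
  have zk : z n ^ k%:Z = 1.
    rewrite zj -cis2pi_mulrz.
    have -> : k%:Z%:~R * (j%:R / k%:R) = j%:Z%:~R * 1 :> R.
      by rewrite mulr1 mulrC divfK// pnatr_eq0; case: (k) k1.
    by rewrite cis2pi_mulrz cis2pi1 exp1rz.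
  have : complex.Re (z n ^ k%:Z) = 1 by rewrite zk.
  rewrite /z -cis2pi_mulrz/= => <-; congr cos.
  by rewrite /t map_polyC/= hornerC; ring.
(* Pointwise [1 <= cos (t n) + 2 * 1_A(n)], the factor 2 being enough because [cos >= -1]. Averaging
   gives terms at least 1 with limit 0. *)
have lim0 : (\sum_(n < N) cos (t n)) / N%:R
    + 2 * (#|[pred n : 'I_N | (n : nat) \in A]|%:R / N%:R) @[N --> \oo]
    --> (0 + 2 * 0 : R).
  by apply: cvgD => //; exact: cvgMl_tmp.
suff : (1 : R) <= 0 + 2 * 0 by rewrite mulr0 addr0 ler10.
apply: (cvgr_to_ge lim0); exists 1%N => //= N N0.
have NR0 : 0 < N%:R :> R by rewrite ltr0n.
rewrite mulrA -mulrDl ler_pdivlMr// mul1r.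
have -> : N%:R = \sum_(n < N) (1 : R) by rewrite big_const_ord iter_addr_0.
rewrite -sum1_card natr_sum mulr_sumr [X in _ <= _ + X]big_mkcond -big_split/=.
apply: ler_sum => n _; rewrite inE; case: ifPn => [|/negP nA].
  by rewrite mulr1 -lerBlDr; have := cos_geN1 (t n); lra.
by rewrite addr0 tA// => /mem_set.
Qed.

(** A shift by [a j] multiplies the phase by [beta ^ a j], so a product of shifted powers is again
    an exponential, with phase multiplied by the value at [beta] of the sum of the [i j X ^ a j]. *)
Lemma Chowla_of_cis_mean0 : Chowla z.
Proof.
split.
  by move=> n; left; exact: normr_cis2pi.
(* The exceptional set for the unit circle is empty, and [not_concentrated] excludes every finite
   index. *)
exists None.
  split=> // [|[k|]//=]; last by move=> k1 /(not_concentrated k1).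
  rewrite /concentrated /density_zero.
  under eq_fun => N.
    rewrite eq_card0; last first.
      move=> n; rewrite !inE; apply/negbTE/negP => /set_mem; apply.
      by left; exact: normr_cis2pi.
    rewrite mul0r; over.
  exact: cvg_cst.
move=> r a i _ a_mono _ [j0 ij0].
pose p : {poly int} := \sum_(j < r) i j *: 'X^(a j).
have a_inj : injective a.
  move=> j k ajk.
  by case: (ltngtP j k) => [/a_mono|/a_mono|/val_inj//]; rewrite ajk ltnn.
(* The shifts are distinct, so no cancellation occurs: the coefficient at [a j0] is exactly
   [i j0]. *)
have p0 : p != 0.
  apply/eqP => /(congr1 (fun q : {poly int} => q`_(a j0))).
  rewrite coef0 coef_sum (bigD1 j0)//= coefZ coefXn eqxx mulr1 big1 ?addr0.
    by apply/eqP.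
  move=> j jj0; rewrite coefZ coefXn; case: eqP => [/a_inj j0j|]; last by rewrite mulr0.
  by rewrite j0j eqxx in jj0.
have E n : \prod_(j < r) power (z (n + a j)%N) (i j) =
    cis2pi (beta ^+ n * ((map_poly intr p).[beta] * gb)).
  under eq_bigr do rewrite /z power_cis2pi.
  rewrite -cis2pi_sum rmorph_sum/= horner_sum mulr_suml mulr_sumr.
  congr cis2pi; apply: eq_bigr => j _.
  by rewrite map_polyZ map_polyXn hornerZ hornerXn exprD/= -!mulrA [LHS]mulrCA.
apply: cvg_trans (cvg0_cis_mean (mean0 p0)).
apply: near_eq_cvg; apply: nearW => N; congr (_ / _); apply: eq_bigr => n _.
rewrite E cis2piE.
have -> : beta ^+ n * (2 * pi * (map_poly intr p).[beta] * gb) =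
  2 * pi * (beta ^+ n * ((map_poly intr p).[beta] * gb)) by ring.
by [].
Qed.

End ChowlaOrbit.

(** * Multiplying the phase by a polynomial, and conclusion *)

Lemma finite_poly_roots (F : fieldType) (p : {poly F}) : p != 0 ->
  finite_set [set x | root p x].
Proof.
have [n] := ubnP (size p); elim: n p => // n IHn p sp p0.
have [[c rc]|nr] := pselect (exists c, root p c); last first.
  rewrite (_ : [set x | _] = set0)//.
  by rewrite -subset0 => x /= rx; apply: nr; exists x.
have [q pE] := factor_theorem _ _ rc.
have q0 : q != 0 by apply: contraNneq p0 => q0; rewrite pE q0 mul0r.
have sq : (size q < n)%N.
  by move: sp; rewrite pE size_Mmonic ?monicXsubC// size_XsubC addn2.
have fin : finite_set ([set x | root q x] `|` [set c]).
  by rewrite finite_setU; split; [exact: IHn|exact: finite_set1].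
apply: sub_finite_set fin => x /=; rewrite pE rootM root_XsubC.
by move=> /orP[|/eqP]; [left|right].
Qed.

Section PolyMultiple.
Variables (R : realType) (g : R -> R) (p : {poly R}).

Let u (x : R) : R := 2 * pi * p.[x] * g x.

(** Multiplying by a nonzero polynomial preserves the regularity of [g] and adds only finitely many
    zeros, so [ae_cis_mean0] still applies. *)
Lemma ae_cis_mean0_poly (g_C2 : C2_on [set` `]1, +oo[] g)
    (g_zeros : countable [set x : R | 1 < x /\ g x = 0]) : p != 0 ->
  {ae (@lebesgue_measure R), forall x : R, 1 < x ->
    cis_mean0 (fun n => x ^+ n * u x)}.
Proof.
move=> p0.
pose k : {poly R} := (2 * pi) *: p.
pose g1 := derive1 g; pose g2 := derive1 g1.
have uE : u = horner k * g by apply/funext => x; rewrite /u /k -hornerZ.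
have gd (x : R) : 1 < x ->
    [/\ is_derive x 1 g (g1 x), is_derive x 1 g1 (g2 x) & {for x, continuous g2}].
  move=> x1; have [|dg dg1 cg2] := g_C2 x; first by rewrite /= in_itv/= x1.
  split; last exact: cg2.
    exact: DeriveDef dg (esym (derive1E g x)).
  exact: DeriveDef dg1 (esym (derive1E g1 x)).
have ck (q : {poly R}) x : {for x, continuous (horner q)}.
  exact: continuous_horner.
(* The first two derivatives of [k * g] by the product rule. *)
apply: (@ae_cis_mean0 R u (horner k * g1 + horner k^`() * g)
  (horner k * g2 + (horner k^`() * g1 + (horner k^`() * g1
    + horner k^`()^`() * g)))).
- move=> x x1; have [dg dg1 cg2] := gd x x1.
  have dk := is_derive_poly k x; have dk1 := is_derive_poly k^`() x.
  have cg : {for x, continuous g}.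
    by apply/differentiable_continuous/derivable1_diffP; case: dg.
  have cg1 : {for x, continuous g1}.
    by apply/differentiable_continuous/derivable1_diffP; case: dg1.
  split.
  + rewrite uE; apply: is_derive_eq (is_deriveM dk dg) _.
    by rewrite /GRing.scale/= [g x * _]mulrC.
  + apply: is_derive_eq (is_deriveD (is_deriveM dk dg1) (is_deriveM dk1 dg)) _.
    rewrite /GRing.scale/= [RHS](_ : _ = k.[x] * g2 x + (k^`().[x] * g1 x
      + (k^`().[x] * g1 x + k^`()^`().[x] * g x)))//; ring.
  + have cM (f h : R -> R) : {for x, continuous f} -> {for x, continuous h} ->
        {for x, continuous (f * h)} by move=> *; exact: cvgM.
    have cD (f h : R -> R) : {for x, continuous f} -> {for x, continuous h} ->
        {for x, continuous (f + h)} by move=> *; exact: cvgD.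
    apply: (cD); first exact: cM.
    apply: (cD); first exact: cM.
    by apply: (cD); exact: cM.
pose Z (b : bool) := if b then [set x : R | 1 < x /\ g x = 0] else [set x | root p x].
have : countable (\bigcup_(b in [set: bool]) Z b).
  apply: bigcup_countable => [|[] _]; first exact: countableP.
    exact: g_zeros.
  exact/finite_set_countable/finite_poly_roots.
apply: sub_countable; apply: subset_card_le => x /= [x1 /eqP].
rewrite /u !mulf_eq0 pnatr_eq0/= (gt_eqF (pi_gt0 R))/=.
by case/orP => [px|/eqP gx]; [exists false|exists true].
Qed.

End PolyMultiple.

Theorem theorem4p3 (R : realType) (g : R -> R)
  (g_C2 : C2_on [set` `]1, +oo[] g)
  (g_zeros : countable [set x : R | 1 < x /\ g x = 0]) :
  {ae (@lebesgue_measure R), forall beta : R, 1 < beta ->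
     Chowla (fun n : nat => cis2pi (beta ^+ n * g beta))}.
Proof.
(* The null set must not depend on the polynomial; this is where the countability of [{poly int}]
   enters. *)
have H : {ae (@lebesgue_measure R), forall x, forall p : {poly int}, p != 0 ->
    1 < x -> cis_mean0 (fun n => x ^+ n * (2 * pi * (map_poly intr p).[x] * g x))}.
  apply: ae_forall_countable => p.
  have [->|p0] := eqVneq p 0; first by apply: aeW => x /eqP.
  have mp0 : map_poly intr p != 0 :> {poly R}.
    have -> : 0 = map_poly intr (0 : {poly int}) :> {poly R} by rewrite rmorph0.
    by rewrite (inj_eq (map_inj_poly (@intr_inj R) _)).
  have := ae_cis_mean0_poly g_C2 g_zeros mp0.
  apply: filterS; first exact: (ae_filter_ringOfSetsType (@lebesgue_measure R)).
  by move=> x Hx _; exact: Hx.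
move: H; apply: filterS; first exact: (ae_filter_ringOfSetsType (@lebesgue_measure R)).
move=> x Hx x1; apply: Chowla_of_cis_mean0 => p p0.
exact: Hx.
Qed.
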